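(* Fix a constant $c\ge 0$. There exist a polynomial $p$ and a polynomial-time algorithm $M$ such that for every STRIPS instance $D_o$ there is a string $A_o$ with $|A_o|\le p(|D_o|)$ such that, for every STRIPS instance $D$ that has the same conditions and operators as $D_o$ and differs from $D_o$ in at most $c$ conditions of the initial state or the goal, $M(D_o,A_o,D)$ accepts iff $D$ has a plan. *)

(* Defs.v *)
From mathcomp Require Import all_boot.
Set Implicit Arguments. Unset Strict Implicit. Unset Printing Implicit Defensive.

Definition peval (p : seq nat) (n : nat) : nat :=
  foldr (fun a acc => a + n * acc) 0 p.

(* Model of computation: deterministic one-tape Turing machines with   *)
(* finitely many states, tape alphabet {0,1,blank}, tape infinite in   *)
(* both directions. A transition either halts with an answer           *)
(* (inl true = accept, inl false = reject) or gives the next state,    *)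
(* the symbol written and the head move.                               *)
Inductive move := MoveL | MoveR | Stay.
Definition sym := option bool.   (* None = blank *)

Record TM := mkTM {
  tm_n : nat;                     (* states are 'I_(tm_n.+1), start = ord0 *)
  tm_delta : 'I_tm_n.+1 -> sym -> bool + ('I_tm_n.+1 * sym * move)
}.

(* configuration: state, left part (nearest cell first), head symbol, right part *)
Definition config (M : TM) := ('I_(tm_n M).+1 * seq sym * sym * seq sym)%type.

Definition move_head (l : seq sym) (h : sym) (r : seq sym) (d : move)
  : seq sym * sym * seq sym :=
  match d with
  | Stay => (l, h, r)
  | MoveL => match l with
             | [::] => ([::], None, h :: r)
             | x :: l' => (l', x, h :: r)
             end
  | MoveR => match r with
             | [::] => (h :: l, None, [::])
             | x :: r' => (h :: l, x, r')
             end
  end.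

Definition step (M : TM) (c : config M) : bool + config M :=
  let: (q, l, h, r) := c in
  match tm_delta q h with
  | inl b => inl b
  | inr (q', w, d) => let: (l', h', r') := move_head l w r d in inr (q', l', h', r')
  end.

Fixpoint run (M : TM) (t : nat) (c : config M) : option bool :=
  match t with
  | 0 => None
  | t'.+1 => match step c with
             | inl b => Some b
             | inr c' => run t' c'
             end
  end.

Definition init_config (M : TM) (w : seq bool) : config M :=
  match w with
  | [::] => (ord0, [::], None, [::])
  | b :: w' => (ord0, [::], Some b, map Some w')
  end.

Definition poly_time (M : TM) (tp : seq nat) : Prop :=
  forall w : seq bool, exists b, run (peval tp (size w)) (init_config M w) = Some b.

Definition accepts_in (M : TM) (tp : seq nat) (w : seq bool) : Prop :=
  run (peval tp (size w)) (init_config M w) = Some true.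

(* Propositional STRIPS (Bylander-style).  Conditions are 0 .. nc-1.   *)
Definition operator := (seq nat * seq nat * seq nat * seq nat)%type.
Definition op_pre_pos (o : operator) := o.1.1.1.
Definition op_pre_neg (o : operator) := o.1.1.2.
Definition op_add (o : operator) := o.1.2.
Definition op_del (o : operator) := o.2.

Record strips := Strips {
  s_nc : nat;
  s_ops : seq operator;
  s_init : seq nat;
  s_goal_pos : seq nat;
  s_goal_neg : seq nat
}.

Definition in_range (nc : nat) (s : seq nat) := all (fun x => x < nc) s.

Definition wf_strips (D : strips) : bool :=
  [&& all (fun o => [&& in_range (s_nc D) (op_pre_pos o), in_range (s_nc D) (op_pre_neg o),
                        in_range (s_nc D) (op_add o) & in_range (s_nc D) (op_del o)])
          (s_ops D),
      in_range (s_nc D) (s_init D), in_range (s_nc D) (s_goal_pos D)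
    & in_range (s_nc D) (s_goal_neg D)].

Definition state := nat -> bool.

Definition applicable (o : operator) (S : state) : bool :=
  all S (op_pre_pos o) && all (fun x => ~~ S x) (op_pre_neg o).

Definition apply_op (o : operator) (S : state) : state :=
  fun x => (x \in op_add o) || (S x && (x \notin op_del o)).

Fixpoint exec (S : state) (plan : seq operator) : option state :=
  match plan with
  | [::] => Some S
  | o :: plan' => if applicable o S then exec (apply_op o S) plan' else None
  end.

Definition satisfies_goal (D : strips) (S : state) : bool :=
  all S (s_goal_pos D) && all (fun x => ~~ S x) (s_goal_neg D).

Definition has_plan (D : strips) : Prop :=
  exists plan : seq operator,
    all (fun o => o \in s_ops D) plan /\
    exists S, exec (fun x => x \in s_init D) plan = Some S /\ satisfies_goal D S.

Definition same_domain (D1 D2 : strips) : Prop :=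
  s_nc D1 = s_nc D2 /\ s_ops D1 = s_ops D2.

Definition set_diff_count (nc : nat) (s t : seq nat) : nat :=
  count (fun x => (x \in s) != (x \in t)) (iota 0 nc).

Definition n_changes (D1 D2 : strips) : nat :=
  set_diff_count (s_nc D1) (s_init D1) (s_init D2)
  + set_diff_count (s_nc D1) (s_goal_pos D1) (s_goal_pos D2)
  + set_diff_count (s_nc D1) (s_goal_neg D1) (s_goal_neg D2).

(* Encodings as binary strings (prefix-free).                         *)
Definition enc_nat (n : nat) : seq bool := rcons (nseq n true) false.
Definition enc_list (T : Type) (f : T -> seq bool) (s : seq T) : seq bool :=
  rcons (flatten (map (fun x => true :: f x) s)) false.
Definition enc_set (s : seq nat) := enc_list enc_nat s.
Definition enc_op (o : operator) : seq bool :=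
  enc_set (op_pre_pos o) ++ enc_set (op_pre_neg o) ++ enc_set (op_add o) ++ enc_set (op_del o).
Definition enc_strips (D : strips) : seq bool :=
  enc_nat (s_nc D) ++ enc_list enc_op (s_ops D) ++ enc_set (s_init D)
  ++ enc_set (s_goal_pos D) ++ enc_set (s_goal_neg D).
Definition enc_string (a : seq bool) : seq bool := enc_list (fun b => [:: b]) a.

Definition enc_triple (Do : strips) (A : seq bool) (D : strips) : seq bool :=
  enc_strips Do ++ enc_string A ++ enc_strips D.

(* Main.v *)
From HB Require Import structures.
From Stdlib Require Import Classical.
Require Import Defs.
From mathcomp Require Import all_boot.
From mathcomp Require Import zify.
Set Implicit Arguments. Unset Strict Implicit. Unset Printing Implicit Defensive.

(* There are polynomially many ways of making at most [c] changes to [Do]; the advice lists,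
   as bit tables, the changed instances that have a plan, and [D] has a plan iff it
   agrees, as a triple of sets, with one of the listed tables.  To compare on one tape in
   polynomial time, the machine reads its input from left to right and, after each bit, makes
   one letter-to-letter pass over the part already read.  While a set of [D] is being read,
   every row of the advice holds a pointer: each unary digit moves all pointers one cell to
   the right in a single pass, and the end of an element marks the cells pointed at and
   sends the pointers home.  In the end a row is good if marked cells and listed
   cells coincide.  As every input bit costs one pass, the running time is quadratic on all
   inputs. *)

(** * Sweeping machines *)

Lemma run_mono (M : TM) t t' (x : config M) b :
  t <= t' -> run t x = Some b -> run t' x = Some b.
Proof.
elim: t t' x => [|t IH] [|t'] x //= tt'.
by case: (step x) => // y; exact: IH.
Qed.

Section Sweep.
Variables (C W : Type) (sweep1 : C -> W -> bool -> W * bool).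

(** Run of a letter-to-letter transducer: the command [c] is fixed during the pass, the register [w]
    evolves. *)
Fixpoint sweep (c : C) (w : W) (u : seq bool) : W * seq bool :=
  if u is x :: u' then
    let: (w1, y) := sweep1 c w x in
    let: (w2, v) := sweep c w1 u' in (w2, y :: v)
  else (w, [::]).

Lemma sweep_cat c w u v :
  sweep c w (u ++ v) =
  let: (w1, u1) := sweep c w u in let: (w2, v1) := sweep c w1 v in (w2, u1 ++ v1).
Proof.
elim: u w => [|x u IH] w /=; first by case: (sweep c w v).
case: (sweep1 c w x) => w1 y; rewrite IH.
by case: (sweep c w1 u) => w2 u1; case: (sweep c w2 v).
Qed.

Lemma size_sweep c w u : size (sweep c w u).2 = size u.
Proof.
elim: u w => //= x u IH w; case: (sweep1 c w x) => w1 y.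
by have:= IH w1; case: (sweep c w1 u) => w2 v /= ->.
Qed.

End Sweep.

(** * Passes carried out by a one-tape Turing machine *)

Section SweepingMachine.
Variables (P C W : finType) (p0 : P) (c0 : C) (w0 : W).
Variables (parse : P -> bool -> P * C * bool) (sweep1 : C -> W -> bool -> W * bool).
Variable (accept : W -> bool).

Definition absorb (x : P * seq bool) (b : bool) : P * seq bool :=
  let: (p, c, b') := parse x.1 b in (p, rcons (sweep sweep1 c w0 x.2).2 b').

Definition verdict (x : P * seq bool) : bool := accept (sweep sweep1 c0 w0 x.2).1.

(* [inl p] reads the next input cell in parser state [p]; [inr (p, c, o, None)] walks back
   to the left end; [inr (p, c, o, Some w)] sweeps right, up to the blank that stands for
   the cell being read, where [o] is to be written ([None] once the input is exhausted). *)
Definition mstate := (P + P * C * option bool * option W)%type.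

Definition mdelta (q : mstate) (x : sym) : bool + mstate * sym * move :=
  match q, x with
  | inl p, Some b =>
      let: (p', c, b') := parse p b in inr (inr (p', c, Some b', None), None, MoveL)
  | inl p, None => inr (inr (p, c0, None, None), None, MoveL)
  | inr (_, None), Some y => inr (q, Some y, MoveL)
  | inr (pco, None), None => inr (inr (pco, Some w0), None, MoveR)
  | inr (pco, Some w), Some y =>
      let: (w', y') := sweep1 pco.1.2 w y in inr (inr (pco, Some w'), Some y', MoveR)
  | inr (pco, Some w), None =>
      if pco.2 is Some b then inr (inl pco.1.1, Some b, MoveR) else inl (accept w)
  end.

(** [inl p0] is put in front so that it gets index 0, which [TM] imposes on the start state. *)
Let states : seq mstate := inl p0 :: enum {: mstate}.
Definition encode (q : mstate) : 'I_(size (enum {: mstate})).+1 := inord (index q states).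
Definition decode (i : 'I_(size (enum {: mstate})).+1) : mstate := nth (inl p0) states i.

Lemma encodeK : cancel encode decode.
Proof.
move=> q; have q_in : q \in states by rewrite inE mem_enum orbT.
by rewrite /decode inordK ?nth_index //; rewrite -index_mem in q_in.
Qed.

Lemma encode_start : encode (inl p0) = ord0.
Proof. by apply: val_inj; rewrite /= inordK /= eqxx. Qed.

Definition machine : TM :=
  mkTM (fun i x => match mdelta (decode i) x with
                   | inl b => inl b
                   | inr (q, y, d) => inr (encode q, y, d)
                   end).

(** The head stands on the first cell of [l], or on a blank if [l] is empty; move lemmas then need
    no case on the border of the visited tape. *)
Definition at_left (q : mstate) (l r : seq sym) : config machine :=
  (encode q, behead l, head None l, r).
Definition at_right (q : mstate) (l r : seq sym) : config machine :=
  (encode q, l, head None r, behead r).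

Lemma run_moveL q l h r t q' y : mdelta q h = inr (q', y, MoveL) ->
  run t.+1 ((encode q, l, h, r) : config machine) = run t (at_left q' l (y :: r)).
Proof. by move=> dE; rewrite /= encodeK dE; case: l. Qed.

Lemma run_moveR q l h r t q' y : mdelta q h = inr (q', y, MoveR) ->
  run t.+1 ((encode q, l, h, r) : config machine) = run t (at_right q' (y :: l) r).
Proof. by move=> dE; rewrite /= encodeK dE; case: r. Qed.

(** [pad] is empty before the first visit to the left border and a single blank afterwards; both
    read as a blank, where the machine turns round. *)
Lemma run_left pco ru pad r t : nilp (behead pad) -> head None pad = None ->
  run ((size ru).+1 + t) (at_left (inr (pco, None)) (map Some ru ++ pad) r) =
  run t (at_right (inr (pco, Some w0)) [:: None] (catrev (map Some ru) r)).
Proof.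
move=> /nilP pad1 pad0.
elim: ru r => [|x ru IH] r.
  by rewrite /at_left pad0 pad1 add1n; exact: run_moveR.
by rewrite addSn -IH; exact: run_moveL.
Qed.

Lemma run_sweep pco w u l r t :
  run (size u + t) (at_right (inr (pco, Some w)) l (map Some u ++ r)) =
  run t (at_right (inr (pco, Some (sweep sweep1 pco.1.2 w u).1))
                  (catrev (map Some (sweep sweep1 pco.1.2 w u).2) l) r).
Proof.
elim: u w l => [|x u IH] w l //.
rewrite addSn [sweep _ _ _ _]/=; case sweepE: (sweep1 pco.1.2 w x) => [w1 y].
apply: etrans (run_moveR _ _ _ (q' := inr (pco, Some w1)) (y := Some y) _) _.
  by rewrite /= sweepE.
by rewrite IH; case: (sweep sweep1 pco.1.2 w1 u).
Qed.

Lemma run_pass pco u pad r t : nilp (behead pad) -> head None pad = None ->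
  run ((size u).+1 + (size u + t))
    (at_left (inr (pco, None)) (map Some (rev u) ++ pad) r) =
  run t (at_right (inr (pco, Some (sweep sweep1 pco.1.2 w0 u).1))
           (map Some (rev (sweep sweep1 pco.1.2 w0 u).2) ++ [:: None]) r).
Proof.
move=> pad1 pad0; have := run_left pco (rev u) r (size u + t) pad1 pad0.
rewrite size_rev => ->.
by rewrite catrevE -map_rev revK run_sweep catrevE -map_rev.
Qed.

(** A bit costs [(size u).*2 + 3] steps: one to blank its cell, [(size u).+1] to walk back and turn,
    [size u] to sweep, one to write. The final pass costs as much, its last step being the halt. The
    sum [size u + size w] is invariant. *)
Lemma run_machine p u w pad t : nilp (behead pad) -> head None pad = None ->
  (size w).+1 * ((size u + size w).*2 + 3) <= t ->
  run t (at_right (inl p) (map Some (rev u) ++ pad) (map Some w)) =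
  Some (verdict (foldl absorb (p, u) w)).
Proof.
elim: w p u pad t => [|b w IH] p u pad t pad1 pad0 /= t_ge.
  apply: run_mono t_ge _.
  have -> : 1 * ((size u + 0).*2 + 3) = ((size u).+1 + (size u + 1)).+1 by lia.
  rewrite /at_right (@run_moveL _ _ _ _ _ (inr (p, c0, None, None)) None) //.
  by rewrite run_pass //= encodeK.
case parseE: (parse p b) => [[p' c] b'].
rewrite mulSn -(addSnnS (size u)) addSn in t_ge.
have [t' tE] : exists t', t = ((size u).+1 + (size u + t'.+1)).+1.
  by exists (t - (size u + size u + 3)); lia.
rewrite tE; apply: etrans (run_moveL _ _ _ (q' := inr (p', c, Some b', None)) (y := None) _) _.
  by rewrite /= parseE.
rewrite run_pass //; apply: etrans (run_moveR _ _ _ (q' := inl p') (y := Some b') _) _ => //.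
rewrite -cat_cons -/(map Some (b' :: _)) -rev_rcons IH //.
  by rewrite /absorb parseE.
by rewrite size_rcons size_sweep addSn; lia.
Qed.

Lemma run_init w :
  run (peval [:: 3; 5; 2] (size w)) (init_config machine w) =
  Some (verdict (foldl absorb (p0, [::]) w)).
Proof.
have -> : init_config machine w = at_right (inl p0) (map Some (rev [::]) ++ [::]) (map Some w).
  by case: w => [|b w]; rewrite /at_right encode_start.
(* The polynomial [3 + 5n + 2n^2] factors as [(n + 1)(2n + 3)]. *)
apply: run_machine => //; rewrite add0n /peval /=; nia.
Qed.

End SweepingMachine.

(** * The advice table and the verifier *)

Lemma flatten_map_cons (T U : Type) (f : T -> seq U) x s :
  flatten [seq f i | i <- x :: s] = f x ++ flatten [seq f i | i <- s].
Proof. by []. Qed.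

Inductive kind := Init | GoalPos | GoalNeg.

(** Codes such as this one transport finiteness, which machine states require. *)
Definition kind_code (k : kind) : option bool :=
  match k with Init => None | GoalPos => Some false | GoalNeg => Some true end.
Definition kind_decode (x : option bool) : kind :=
  match x with None => Init | Some false => GoalPos | Some true => GoalNeg end.
Lemma kind_codeK : cancel kind_code kind_decode. Proof. by case. Qed.
HB.instance Definition _ := Finite.copy kind (can_type kind_codeK).

Definition instance_set (D : strips) (k : kind) : seq nat :=
  match k with
  | Init => s_init D
  | GoalPos => s_goal_pos D
  | GoalNeg => s_goal_neg D
  end.

Inductive command := Idle | Advance | Mark of kind.

Definition command_code (c : command) : option (option kind) :=
  match c with Idle => None | Advance => Some None | Mark k => Some (Some k) end.
Definition command_decode (x : option (option kind)) : command :=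
  match x with None => Idle | Some None => Advance | Some (Some k) => Mark k end.
Lemma command_codeK : cancel command_code command_decode. Proof. by case. Qed.
HB.instance Definition _ := Finite.copy command (can_type command_codeK).

(** Position inside an eight-bit cell: [Seen k] holds what has been read of [D], [Want k] what the
    row lists. *)
Inductive field := First | Ptr | Seen of kind | Want of kind.

Definition field_code (f : field) : bool + bool * kind :=
  match f with
  | First => inl false | Ptr => inl true
  | Seen k => inr (false, k) | Want k => inr (true, k)
  end.
Definition field_decode (x : bool + bool * kind) : field :=
  match x with
  | inl false => First | inl true => Ptr
  | inr (false, k) => Seen k | inr (true, k) => Want k
  end.
Lemma field_codeK : cancel field_code field_decode. Proof. by case. Qed.
HB.instance Definition _ := Finite.copy field (can_type field_codeK).

Definition next_kind (k : kind) : option kind :=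
  match k with Init => Some GoalPos | GoalPos => Some GoalNeg | GoalNeg => None end.

Definition cell (first ptr : bool) (seen want : kind -> bool) : seq bool :=
  [:: first; ptr; seen Init; want Init; seen GoalPos; want GoalPos;
      seen GoalNeg; want GoalNeg].

(* Registers: the pointer bit carried along the row, the last [Seen] bit written, whether
   the current row agrees so far, and whether an earlier row agreed. *)
Definition work := (field * (bool * bool * bool * bool))%type.

(** A pointer moves by writing the carried bit and carrying the old one. At the [First] bit of a
    row, [Advance] clears the carry so that no pointer crosses rows, while [Mark] sets it and
    thereby puts the pointer home. The verdict on a row enters [found] only when the next row
    starts. *)
Definition work_step (c : command) (w : work) (b : bool) : work * bool :=
  let: (fd, (carry, last, ok, found)) := w in
  match fd with
  | First =>
      let carry' := if c is Advance then carry && ~~ b else b in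
      if b then ((Ptr, (carry', last, true, found || ok)), b)
      else ((Ptr, (carry', last, ok, found)), b)
  | Ptr => ((Seen Init, (b, last, ok, found)), if c is Idle then b else carry)
  | Seen k =>
      let b' := b || (if c is Mark k' then (k == k') && carry else false) in
      ((Want k, (carry, b', ok, found)), b')
  | Want k =>
      ((if next_kind k is Some k' then Seen k' else First,
        (carry, last, ok && (last == b), found)), b)
  end.

Definition work0 : work := (First, (false, false, false, false)).

Definition move_ptr (c : command) (ptr : nat) : nat :=
  match c with Idle => ptr | Advance => ptr.+1 | Mark _ => 0 end.

Definition mark (c : command) (ptr : nat) (S : kind -> nat -> bool) : kind -> nat -> bool :=
  if c is Mark k then fun k' i => S k' i || (k' == k) && (i == ptr) else S.

Definition agree_at (S E : kind -> nat -> bool) (i : nat) : bool :=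
  [&& S Init i == E Init i, S GoalPos i == E GoalPos i & S GoalNeg i == E GoalNeg i].

Definition cell_at (ptr : nat) (S E : kind -> nat -> bool) (i : nat) : seq bool :=
  cell (i == 0) (i == ptr) (S^~ i) (E^~ i).

(* Condition [i] lives in cell [i.+1]; cell [0] is the home of the pointer, left with the
   leading [true] of an element. *)
Definition row (n ptr : nat) (S E : kind -> nat -> bool) : seq bool :=
  flatten [seq cell_at ptr S E i | i <- iota 0 n.+1].

Definition table (n : nat) (rows : seq (kind -> nat -> bool)) (ptr : nat)
    (S : kind -> nat -> bool) : seq bool :=
  flatten [seq row n ptr S E | E <- rows].

(** For [0 < i] the carry is the old pointer bit of cell [i.-1]; at [i = 0] it is left over from
    whatever precedes the row. *)
Lemma sweep_cell c ptr S E i carry last ok found :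
  (0 < i -> carry = (i == ptr.+1)) ->
  exists last', sweep work_step c (First, (carry, last, ok, found)) (cell_at ptr S E i) =
    ((First, (i == ptr, last', ((i == 0) || ok) && agree_at (mark c ptr S) E i,
              found || (i == 0) && ok)),
     cell_at (move_ptr c ptr) (mark c ptr S) E i).
Proof.
move=> carryE; exists (mark c ptr S GoalNeg i).
rewrite /agree_at /cell_at /cell /=; case: i carryE => [_|i /(_ isT) ->] /=; case: c => [||k];
  rewrite /= ?orbF ?andbT ?andbF ?eqxx ?andbA //.
Qed.

Lemma sweep_cells c ptr S E m n carry last ok found : 0 < m -> carry = (m == ptr.+1) ->
  exists carry' last',
  sweep work_step c (First, (carry, last, ok, found))
    (flatten [seq cell_at ptr S E i | i <- iota m n]) =
  ((First, (carry', last', ok && all (agree_at (mark c ptr S) E) (iota m n), found)),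
   flatten [seq cell_at (move_ptr c ptr) (mark c ptr S) E i | i <- iota m n]).
Proof.
elim: n m carry last ok => [|n IH] m carry last ok m0 carryE.
  by exists carry, last; rewrite /= andbT.
have [last1 cellE] := sweep_cell c S E last ok found (fun _ => carryE).
have [carry2 [last2 cellsE]] :=
  IH m.+1 (m == ptr) last1 (ok && agree_at (mark c ptr S) E m) isT erefl.
exists carry2, last2; rewrite [iota m n.+1]/= !flatten_map_cons sweep_cat cellE.
by rewrite (gtn_eqF m0) andFb orbF orFb cellsE /= andbA.
Qed.

Lemma sweep_row c n ptr S E carry last ok found :
  exists carry' last',
  sweep work_step c (First, (carry, last, ok, found)) (row n ptr S E) =
  ((First, (carry', last', all (agree_at (mark c ptr S) E) (iota 0 n.+1), found || ok)),
   row n (move_ptr c ptr) (mark c ptr S) E).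
Proof.
have [last1 cellE] := @sweep_cell c ptr S E 0 carry last ok found (fun h => False_ind _ (notF h)).
have [carry2 [last2 cellsE]] :=
  @sweep_cells c ptr S E 1 n (0 == ptr) last1 (agree_at (mark c ptr S) E 0) (found || ok) isT erefl.
exists carry2, last2; rewrite /row [iota 0 n.+1]/= !flatten_map_cons sweep_cat cellE.
by rewrite eqxx orTb !andTb cellsE.
Qed.

(** Only the disjunction is tracked, because the verdict on the last row is still in [ok] at the
    end. *)
Lemma sweep_table c n rows ptr S carry last ok found :
  exists carry' last' ok' found',
  sweep work_step c (First, (carry, last, ok, found)) (table n rows ptr S) =
  ((First, (carry', last', ok', found')), table n rows (move_ptr c ptr) (mark c ptr S)) /\
  found' || ok' =
  [|| found, ok | has (fun E => all (agree_at (mark c ptr S) E) (iota 0 n.+1)) rows].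
Proof.
elim: rows carry last ok found => [|E rows IH] carry last ok found.
  by exists carry, last, ok, found; rewrite /= orbF.
have [carry1 [last1 rowE]] := sweep_row c n ptr S E carry last ok found.
have [carry2 [last2 [ok2 [found2 [tableE foundE]]]]] :=
  IH carry1 last1 (all (agree_at (mark c ptr S) E) (iota 0 n.+1)) (found || ok).
exists carry2, last2, ok2, found2; split; last by rewrite foundE [has _ (_ :: _)]/= !orbA.
by rewrite /table !flatten_map_cons sweep_cat rowE tableE.
Qed.

(** * Passes over the whole tape *)

Definition effect (c : command) (v : seq bool) : seq bool := (sweep work_step c work0 v).2.

Lemma effect_table c n rows ptr S :
  effect c (table n rows ptr S) = table n rows (move_ptr c ptr) (mark c ptr S).
Proof.
by have [? [? [? [? [E _]]]]] := sweep_table c n rows ptr S false false false false;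
  rewrite /effect E.
Qed.

(* The flag tells whether the next bit is the payload of a pair; a [false] in the leading
   position of a pair is skipped, so that blocks of zeros are inert. *)
Definition sweep_step (c : command) (w : bool * work) (b : bool) : bool * work * bool :=
  if w.1 then let: (w', b') := work_step c w.2 b in ((false, w'), b')
  else ((b, w.2), b).

Definition pairs (v : seq bool) : seq bool := flatten [seq [:: true; x] | x <- v].

Lemma pairs_rcons v x : pairs (rcons v x) = rcons (rcons (pairs v) true) x.
Proof. by rewrite /pairs map_rcons flatten_rcons -!cats1 -catA. Qed.

Lemma sweep_zeros c w n :
  sweep sweep_step c (false, w) (nseq n false) = ((false, w), nseq n false).
Proof. by elim: n => //= n ->. Qed.

Lemma sweep_pairs c w v :
  sweep sweep_step c (false, w) (pairs v) =
  ((false, (sweep work_step c w v).1), pairs (sweep work_step c w v).2).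
Proof.
elim: v w => //= x v IH w; rewrite {1}/sweep_step /=.
by case: (work_step c w x) => w1 y; rewrite IH; case: (sweep work_step c w1 v).
Qed.

(** Holds for every word and register: while the advice is being read, the tape may end in the
    middle of a pair. *)
Lemma sweep_idle w u : (sweep sweep_step Idle w u).2 = u.
Proof.
elim: u w => //= x u IH w.
suff [w1 ->] : exists w1, sweep_step Idle w x = (w1, x).
  by have := IH w1; case: (sweep _ _ w1 u) => w2 v /= ->.
case: w => [[] [fd [[[carry last] ok] found]]]; last by exists (x, (fd, (carry, last, ok, found))).
rewrite /sweep_step /=; case: fd => [||k|k]; [case: x| | |]; rewrite ?orbF; by eexists.
Qed.

(** Erased bits of [Do], then the advice in its input encoding without terminator, then a block of
    zeros. *)
Definition tape (a : nat) (v : seq bool) (b : nat) : seq bool :=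
  nseq a false ++ pairs v ++ nseq b false.

Lemma tapeS a v b : rcons (tape a v b) false = tape a v b.+1.
Proof. by rewrite /tape !rcons_cat -cats1 -(addn1 b) nseqD. Qed.

Lemma tape_nil a b : tape a [::] b = tape (a + b) [::] 0.
Proof. by rewrite /tape /= cats0 nseqD. Qed.

Lemma sweep_tape c a v b :
  sweep sweep_step c (false, work0) (tape a v b) =
  ((false, (sweep work_step c work0 v).1), tape a (effect c v) b).
Proof.
by rewrite /tape sweep_cat sweep_zeros sweep_cat sweep_pairs sweep_zeros.
Qed.

(** * Parsing the input *)

(* The sets of an encoded instance: the four sets of an operator, then the three others. *)
Definition slot := (bool * bool + kind)%type.

Inductive position := InNat | OpsHead | SetHead of slot | InItem of slot.

Definition position_code (s : position) : bool + bool * slot :=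
  match s with
  | InNat => inl false | OpsHead => inl true
  | SetHead j => inr (false, j) | InItem j => inr (true, j)
  end.
Definition position_decode (x : bool + bool * slot) : position :=
  match x with
  | inl false => InNat | inl true => OpsHead
  | inr (false, j) => SetHead j | inr (true, j) => InItem j
  end.
Lemma position_codeK : cancel position_code position_decode. Proof. by case. Qed.
HB.instance Definition _ := Finite.copy position (can_type position_codeK).

(** The flag of [Instance] is [false] for [Do] and [true] for [D]. *)
Inductive phase := Instance of bool & position | AdviceHead | AdviceBit | Done.

Definition phase_code (p : phase) : bool * position + option bool :=
  match p with
  | Instance t s => inl (t, s)
  | AdviceHead => inr (Some false) | AdviceBit => inr (Some true) | Done => inr None
  end.
Definition phase_decode (x : bool * position + option bool) : phase :=
  match x with
  | inl (t, s) => Instance t s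
  | inr (Some false) => AdviceHead | inr (Some true) => AdviceBit | inr None => Done
  end.
Lemma phase_codeK : cancel phase_code phase_decode. Proof. by case. Qed.
HB.instance Definition _ := Finite.copy phase (can_type phase_codeK).

Definition after_instance (t : bool) : phase := if t then Done else AdviceHead.

Definition after_set (t : bool) (j : slot) : phase :=
  match j with
  | inl (false, false) => Instance t (SetHead (inl (false, true)))
  | inl (false, true) => Instance t (SetHead (inl (true, false)))
  | inl (true, false) => Instance t (SetHead (inl (true, true)))
  | inl (true, true) => Instance t OpsHead
  | inr k => if next_kind k is Some k' then Instance t (SetHead (inr k'))
             else after_instance t
  end.

Definition next_phase (t : bool) (s : position) (b : bool) : phase :=
  match s, b with
  | InNat, true => Instance t InNat
  | InNat, false => Instance t OpsHead
  | OpsHead, true => Instance t (SetHead (inl (false, false)))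
  | OpsHead, false => Instance t (SetHead (inr Init))
  | SetHead j, true | InItem j, true => Instance t (InItem j)
  | SetHead j, false => after_set t j
  | InItem j, false => Instance t (SetHead j)
  end.

(** The leading [true] of an element also advances, so condition [x] is marked in cell [x.+1].
    Operators, common to [Do] and [D], trigger nothing. *)
Definition command_at (s : position) (b : bool) : command :=
  match s, b with
  | SetHead (inr _), true | InItem (inr _), true => Advance
  | InItem (inr k), false => Mark k
  | _, _ => Idle
  end.

Definition parse (p : phase) (b : bool) : phase * command * bool :=
  match p with
  | Instance t s => (next_phase t s b, command_at s b, false)
  | AdviceHead => (if b then AdviceBit else Instance true InNat, Idle, b)
  | AdviceBit => (AdviceHead, Idle, b)
  | Done => (Done, Idle, false)
  end.

Notation consume := (absorb (false, work0) parse sweep_step).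

Lemma effect_idle v : effect Idle v = v.
Proof.
have /(congr1 snd) := sweep_tape Idle 0 v 0.
rewrite sweep_idle /tape /= !cats0 /=.
(* This is the injectivity of [pairs]. *)
elim: v (effect Idle v) => [|x v IH] [|y u] //= [<- /IH -> //].
Qed.

(** Trailing zeros are inert, so their number is hidden, which lets the relation compose. *)
Definition reads (p : phase) (v w : seq bool) (p' : phase) (v' : seq bool) : Prop :=
  forall a b, exists b', foldl consume (p, tape a v b) w = (p', tape a v' b').

Lemma reads_nil p v : reads p v [::] p v. Proof. by move=> a b; exists b. Qed.

Lemma reads_cat p1 v1 w1 p2 v2 w2 p3 v3 :
  reads p1 v1 w1 p2 v2 -> reads p2 v2 w2 p3 v3 -> reads p1 v1 (w1 ++ w2) p3 v3.
Proof.
move=> r1 r2 a b; have [b1 E1] := r1 a b; have [b2 E2] := r2 a b1.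
by exists b2; rewrite foldl_cat E1.
Qed.

Lemma reads_bit t s v b :
  reads (Instance t s) v [:: b] (next_phase t s b) (effect (command_at s b) v).
Proof. by move=> a z; exists z.+1; rewrite /= /absorb /= sweep_tape tapeS. Qed.

Lemma reads_cons t s v b w p v' :
  reads (next_phase t s b) (effect (command_at s b) v) w p v' ->
  reads (Instance t s) v (b :: w) p v'.
Proof. exact: (reads_cat (reads_bit t s v b)). Qed.

Lemma reads_nat t v n : reads (Instance t InNat) v (enc_nat n) (Instance t OpsHead) v.
Proof.
elim: n => [|n IH]; apply: reads_cons; rewrite effect_idle //; exact: reads_nil.
Qed.

Definition item_effect (j : slot) (v : seq bool) (x : nat) : seq bool :=
  if j is inr k then effect (Mark k) (iter x.+1 (effect Advance) v) else v.

Lemma reads_item t j v x :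
  reads (Instance t (SetHead j)) v (true :: enc_nat x)
        (Instance t (SetHead j)) (item_effect j v x).
Proof.
apply: reads_cons; case: j => [j|k] /=.
  rewrite effect_idle; elim: x => [|x IH]; apply: reads_cons; rewrite /= effect_idle //.
  exact: reads_nil.
rewrite -iterS iterSr; elim: x (effect Advance v) => [|x IH] u; apply: reads_cons.
  exact: reads_nil.
by rewrite iterSr; exact: IH.
Qed.

Lemma reads_set t j v s :
  reads (Instance t (SetHead j)) v (enc_set s) (after_set t j) (foldl (item_effect j) v s).
Proof.
elim: s v => [|x s IH] v.
  have := @reads_bit t (SetHead j) v false.
  have -> : command_at (SetHead j) false = Idle by case: j.
  by rewrite effect_idle.
have -> : enc_set (x :: s) = (true :: enc_nat x) ++ enc_set s.
  by rewrite /enc_set /enc_list -rcons_cat.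
exact: reads_cat (reads_item _ _ _ _) (IH _).
Qed.

Lemma reads_op_set t j v s :
  reads (Instance t (SetHead (inl j))) v (enc_set s) (after_set t (inl j)) v.
Proof.
have := reads_set t (inl j) v s.
by have -> : foldl (item_effect (inl j)) v s = v by elim: s.
Qed.

Lemma reads_op t v o :
  reads (Instance t OpsHead) v (true :: enc_op o) (Instance t OpsHead) v.
Proof.
apply: reads_cons; rewrite effect_idle /enc_op.
do 3!(apply: reads_cat (reads_op_set t _ v _) _); exact: reads_op_set.
Qed.

Lemma reads_ops t v ops :
  reads (Instance t OpsHead) v (enc_list enc_op ops) (Instance t (SetHead (inr Init))) v.
Proof.
elim: ops => [|o ops IH].
  by have := @reads_bit t OpsHead v false; rewrite effect_idle.
rewrite /enc_list /= rcons_cat; exact: (reads_cat (reads_op t v o)).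
Qed.

Definition mark_all (S : kind -> nat -> bool) (k : kind) (s : seq nat) :=
  foldl (fun S x => mark (Mark k) x.+1 S) S s.

Lemma mark_allE S k s k' i :
  mark_all S k s k' i = S k' i || (k' == k) && (i \in map succn s).
Proof.
rewrite /mark_all; elim: s S => [|x s IH] S; first by rewrite andbF orbF.
by rewrite /= IH /= inE andb_orr orbA.
Qed.

(** Each element takes the pointers from home to cell [x.+1], and its [Mark] sends them home
    again. *)
Lemma item_effect_table n rows S k s :
  foldl (item_effect (inr k)) (table n rows 0 S) s = table n rows 0 (mark_all S k s).
Proof.
rewrite /mark_all; elim: s S => //= x s IH S; rewrite -iterS.
have -> : forall y, iter y (effect Advance) (table n rows 0 S) = table n rows y S.
  by elim=> //= y ->; rewrite effect_table.
by rewrite effect_table IH.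
Qed.

Definition seen (D : strips) (k : kind) (i : nat) : bool := i \in map succn (instance_set D k).

Definition unseen (k : kind) (i : nat) : bool := false.

Definition marks (D : strips) : kind -> nat -> bool :=
  mark_all (mark_all (mark_all unseen Init (s_init D)) GoalPos (s_goal_pos D))
    GoalNeg (s_goal_neg D).

Lemma marksE D : marks D =2 seen D.
Proof. by move=> k i; rewrite /marks !mark_allE /seen; case: k; rewrite /= ?orbF. Qed.

Lemma reads_instance t n rows D :
  reads (Instance t InNat) (table n rows 0 unseen) (enc_strips D)
        (after_instance t) (table n rows 0 (marks D)).
Proof.
apply: reads_cat (reads_nat _ _ _) _; apply: reads_cat (reads_ops _ _ _) _.
rewrite /marks -!item_effect_table.
do 2!(apply: reads_cat (reads_set _ _ _ _) _); exact: reads_set.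
Qed.

(** The terminator of the advice becomes the first trailing zero. *)
Lemma consume_advice a v w :
  foldl consume (AdviceHead, tape a v 0) (enc_string w) =
  (Instance true InNat, tape a (v ++ w) 1).
Proof.
have headE u b :
    consume (AdviceHead, u) b = (if b then AdviceBit else Instance true InNat, rcons u b).
  by rewrite /absorb /= sweep_idle.
have bitE u b : consume (AdviceBit, u) b = (AdviceHead, rcons u b).
  by rewrite /absorb /= sweep_idle.
elim: w v => [|x w IH] v; first by rewrite /= headE cats0 tapeS.
rewrite /= headE bitE.
have -> : rcons (rcons (tape a v 0) true) x = tape a (rcons v x) 0.
  by rewrite /tape !cats0 pairs_rcons !rcons_cat.
by rewrite -cat_rcons -IH.
Qed.

(** * Correctness of the verifier *)

Definition accept (w : bool * work) : bool :=
  let: (_, (_, (_, _, ok, found))) := w in found || ok.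

Definition verifier : TM :=
  machine (Instance false InNat) Idle (false, work0) parse sweep_step accept.

Lemma run_verifier w : exists b,
  run (peval [:: 3; 5; 2] (size w)) (init_config verifier w) = Some b.
Proof. by eexists; exact: run_init. Qed.

Lemma accepts_verifier n rows Do D :
  accepts_in verifier [:: 3; 5; 2] (enc_triple Do (table n rows 0 unseen) D) <->
  has (fun E => all (agree_at (seen D) E) (iota 0 n.+1)) rows.
Proof.
rewrite /accepts_in run_init /enc_triple.
rewrite (foldl_cat _ _ (enc_strips Do)) (foldl_cat _ _ (enc_string _)).
(* While [Do] is read the table has no rows: its commands act on nothing and only zeros remain. *)
have [b1 readDo] := reads_instance false 0 [::] Do 0 0.
rewrite [foldl _ _ (enc_strips Do)]readDo [table _ [::] _ _]/=.
rewrite tape_nil consume_advice cat0s.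
have [b2 ->] := reads_instance true n rows D (0 + b1) 1.
rewrite /verdict sweep_tape.
have [? [? [ok [found [-> foundE]]]]] :=
  sweep_table Idle n rows 0 (marks D) false false false false.
rewrite /= foundE /=.
have -> : has (fun E => all (agree_at (marks D) E) (iota 0 n.+1)) rows =
          has (fun E => all (agree_at (seen D) E) (iota 0 n.+1)) rows.
  by apply: eq_has => E; apply: eq_all => i; rewrite /agree_at !marksE.
by split=> [[]|->].
Qed.

(** * Instances with few changes *)

Lemma exec_ext S S' plan T : S =1 S' -> exec S plan = Some T ->
  exists2 T', exec S' plan = Some T' & T =1 T'.
Proof.
elim: plan S S' => [|o plan IH] S S' eqS /=; first by case=> <-; exists S'.
have -> : applicable o S' = applicable o S.
  by rewrite /applicable (eq_all eqS); congr (_ && _); apply: eq_all => x; rewrite eqS.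
case: ifP => // _; apply: IH => x; by rewrite /apply_op eqS.
Qed.

Lemma has_plan_ext D D' : s_ops D = s_ops D' -> (forall k, instance_set D k =i instance_set D' k) ->
  has_plan D -> has_plan D'.
Proof.
move=> eq_ops eq_set [plan [plan_ops [T [planE goalT]]]].
exists plan; split; first by rewrite -eq_ops.
have [T' planE' eqT] := exec_ext (eq_set Init) planE.
exists T'; split=> //; move: goalT; rewrite /satisfies_goal.
rewrite (eq_all_r (eq_set GoalPos)) (eq_all_r (eq_set GoalNeg)).
have eqNT : (fun x => ~~ T x) =1 (fun x => ~~ T' x) by move=> x; rewrite eqT.
by rewrite (eq_all eqT) (eq_all eqNT).
Qed.

(** The advice need only exist, so excluded middle is applied to each element. *)
Lemma exists_filter (T : eqType) (P : T -> Prop) (s : seq T) :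
  exists2 s', size s' <= size s & forall x, x \in s' <-> x \in s /\ P x.
Proof.
elim: s => [|x s [s' size_s' mem_s']]; first by exists [::] => // x; split=> [|[]].
have [Px|nPx] := classic (P x).
  exists (x :: s') => // y; rewrite !inE; split.
    by case/predU1P => [->|/mem_s' [-> ?]]; rewrite ?eqxx ?orbT.
  by case=> /predU1P [->|ys Py]; rewrite ?eqxx //; apply/orP; right; apply/mem_s'.
exists s'; first exact: leqW.
move=> y; rewrite inE mem_s'; split=> [[-> ?]|[/predU1P [->|] //]]; by rewrite orbT.
Qed.

Section Variants.
Variables (Do : strips) (c : nat).
Let nc := s_nc Do.

(* A set of at most [c] changes is padded to length [c] with the vacuous change [nc]. *)
Definition changes := c.-tuple (kind * 'I_nc.+1).

Definition changed (w : changes) (k : kind) (i : nat) : bool :=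
  (k, i) \in [seq (x.1, val x.2) | x <- w].

(** Symmetric difference with the changes, cut to [iota 0 nc] so that the change [nc] is vacuous. *)
Definition changed_set (w : changes) (k : kind) : seq nat :=
  [seq i <- iota 0 nc | (i \in instance_set Do k) (+) changed w k i].

Definition variant (w : changes) : strips :=
  Strips nc (s_ops Do) (changed_set w Init) (changed_set w GoalPos) (changed_set w GoalNeg).

Lemma variant_set w k : instance_set (variant w) k = changed_set w k.
Proof. by case: k. Qed.

Lemma wf_set D k i : wf_strips D -> i \in instance_set D k -> i < s_nc D.
Proof.
case/and4P => _ /allP wfI /allP wfP /allP wfN; case: k => /=; [exact: wfI|exact: wfP|exact: wfN].
Qed.

Definition change_list (D : strips) (k : kind) : seq (kind * 'I_nc.+1) :=
  [seq (k, inord i) | i <- iota 0 nc & (i \in instance_set Do k) != (i \in instance_set D k)].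

Lemma mem_change_list D k k' i : i < nc ->
  ((k, inord i) \in change_list D k') =
  (k == k') && ((i \in instance_set Do k) != (i \in instance_set D k)).
Proof.
move=> i_lt; apply/mapP/andP => [[j]|[/eqP <- neq_i]].
  rewrite mem_filter mem_iota /= add0n => /andP [neq_j j_lt] [-> /(congr1 val)].
  by rewrite /= !inordK ?ltnS 1?ltnW // => ->; rewrite eqxx.
by exists i => //; rewrite mem_filter neq_i mem_iota.
Qed.

Lemma exists_variant D : wf_strips D -> same_domain Do D -> n_changes Do D <= c ->
  exists w, forall k, instance_set D k =i instance_set (variant w) k.
Proof.
move=> wfD [eq_nc _] few.
pose l := change_list D Init ++ change_list D GoalPos ++ change_list D GoalNeg.
have size_l : size l = n_changes Do D.
  by rewrite !size_cat !size_map !size_filter /n_changes addnA.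
have size_w : size (l ++ nseq (c - size l) (Init, ord_max)) == c.
  by rewrite size_cat size_nseq subnKC // size_l.
exists (Tuple size_w) => k i; rewrite variant_set mem_filter mem_iota add0n /=.
case: ltnP => [i_lt|nc_le]; last first.
  rewrite andbF; apply/negbTE/negP => /(wf_set wfD).
  by rewrite -eq_nc ltnNge nc_le.
(* Flipping where the sets differ gives the new set: [a (+) (a != b)] is [b]. *)
rewrite andbT; suff -> : changed (Tuple size_w) k i =
    ((i \in instance_set Do k) != (i \in instance_set D k)).
  by case: (i \in instance_set Do k); case: (i \in instance_set D k).
have -> : changed (Tuple size_w) k i =
    ((k, inord i) \in l ++ nseq (c - size l) (Init, ord_max)).
  rewrite /changed; apply/mapP/idP => [[[k' j] w_in [-> ->]]|w_in].
    by rewrite inord_val.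
  by exists (k, inord i) => //=; rewrite inordK // ltnS ltnW.
rewrite mem_cat.
have -> : ((k, inord i) \in nseq (c - size l) (Init, ord_max : 'I_nc.+1)) = false.
  rewrite mem_nseq xpair_eqE -(inj_eq val_inj) /= inordK ?ltnS ?(ltnW i_lt) //.
  by rewrite (ltn_eqF i_lt) !andbF.
rewrite orbF !mem_cat !mem_change_list //.
by case: k; rewrite /= ?orbF.
Qed.

(** Cell [i.+1] decides condition [i] below [nc]; by well-formedness no larger [i] is in any set. *)
Lemma agree_seenP D D' : wf_strips D -> wf_strips D' -> s_nc D = nc -> s_nc D' = nc ->
  reflect (forall k, instance_set D k =i instance_set D' k)
          (all (agree_at (seen D) (seen D')) (iota 0 nc.+1)).
Proof.
move=> wfD wfD' ncD ncD'; apply: (iffP allP) => [agr k i|eqD i _]; last first.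
  by rewrite /agree_at /seen !(eq_mem_map _ (eqD _)) !eqxx.
have [i_lt|nc_le] := ltnP i nc; last first.
  have notin D1 : wf_strips D1 -> s_nc D1 = nc -> (i \in instance_set D1 k) = false.
    move=> wfD1 ncD1; apply/negP => /(wf_set wfD1).
    by rewrite ncD1 ltnNge nc_le.
  by rewrite !notin.
have /agr /and3P [/eqP aI /eqP aP /eqP aN] : i.+1 \in iota 0 nc.+1 by rewrite mem_iota.
move: aI aP aN; rewrite /seen !(mem_map succn_inj) => aI aP aN.
by case: k.
Qed.

Lemma wf_variant w : wf_strips Do -> wf_strips (variant w).
Proof.
case/and4P => wf_ops _ _ _; rewrite /wf_strips wf_ops /=.
by apply/and3P; split; apply/allP => i; rewrite mem_filter mem_iota add0n => /andP [].
Qed.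

(** The rows are the variants that have a plan, at most one per tuple of changes. [D] has the sets
    of some variant, and having a plan depends only on the operators and these sets. *)
Lemma exists_advice : wf_strips Do ->
  exists rows, size rows <= #|{: kind}| ^ c * nc.+1 ^ c /\
    forall D, wf_strips D -> same_domain Do D -> n_changes Do D <= c ->
      has (fun E => all (agree_at (seen D) E) (iota 0 nc.+1)) rows <-> has_plan D.
Proof.
move=> wfDo.
have [ws size_ws mem_ws] := exists_filter (fun w => has_plan (variant w)) (enum {: changes}).
exists [seq seen (variant w) | w <- ws]; split.
  rewrite size_map; apply: leq_trans size_ws _.
  by rewrite -cardE card_tuple card_prod card_ord expnMn.
move=> D wfD [eq_nc eq_ops] few.
have eq_variant w : reflect (forall k, instance_set D k =i instance_set (variant w) k)
    (all (agree_at (seen D) (seen (variant w))) (iota 0 nc.+1)).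
  by apply: agree_seenP => //; exact: wf_variant.
rewrite has_map; split=> [/hasP [w /mem_ws [_ planw] /eq_variant eqD]|planD].
  by apply: has_plan_ext planw => [|k i]; rewrite -?eq_ops ?eqD.
have [w eqD] := exists_variant wfD (conj eq_nc eq_ops) few.
apply/hasP; exists w; last exact/eq_variant.
apply/mem_ws; split; first by rewrite mem_enum.
by apply: has_plan_ext planD.
Qed.

End Variants.

(** * Size of the advice and conclusion *)

Lemma size_row n ptr S E : size (row n ptr S E) = 8 * n.+1.
Proof.
by rewrite /row size_flatten /shape -map_comp; elim: n.+1 {1}0 => //= m IH i; rewrite IH mulnS.
Qed.

Lemma size_table n rows ptr S : size (table n rows ptr S) = size rows * (8 * n.+1).
Proof.
rewrite /table; elim: rows => // E rows IH.
by rewrite flatten_map_cons size_cat size_row IH mulSn.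
Qed.

Lemma peval_monomial K d n : peval (rcons (nseq d 0) K) n = K * n ^ d.
Proof.
elim: d => [|d IH]; first by rewrite /= muln0 addn0 muln1.
by rewrite /= add0n -/(peval _ n) IH expnS mulnCA.
Qed.

Theorem theorem3 (c : nat) :
  exists (p : seq nat) (M : TM) (tp : seq nat),
    poly_time M tp /\
    forall Do : strips, wf_strips Do ->
      exists A : seq bool,
        size A <= peval p (size (enc_strips Do)) /\
        forall D : strips, wf_strips D -> same_domain Do D -> n_changes Do D <= c ->
          (accepts_in M tp (enc_triple Do A D) <-> has_plan D).
Proof.
(* At most [#|{: kind}| ^ c * nc.+1 ^ c] rows of [8 * nc.+1] bits give a monomial of degree
   [c.+1]. *)
exists (rcons (nseq c.+1 0) (8 * #|{: kind}| ^ c)), verifier, [:: 3; 5; 2].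
split=> [w|Do wfDo]; first exact: run_verifier.
have [rows [size_rows rowsP]] := exists_advice c wfDo.
exists (table (s_nc Do) rows 0 unseen); split; last first.
  by move=> D wfD dom few; rewrite accepts_verifier; exact: rowsP.
(* The encoding starts with the number of conditions in unary. *)
have nc_le : (s_nc Do).+1 <= size (enc_strips Do).
  by rewrite size_cat size_rcons size_nseq leq_addr.
rewrite size_table peval_monomial mulnC -mulnA -mulnA leq_mul2l /=.
apply: (@leq_trans ((s_nc Do).+1 * (#|{: kind}| ^ c * (s_nc Do).+1 ^ c))).
  by rewrite leq_mul2l size_rows orbT.
by rewrite mulnCA -expnS leq_mul2l leq_exp2r // nc_le orbT.
Qed.
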